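(* Assume $h^\pi(s):=\omega\sum_{a\in\mathcal A}\pi(a|s)\log\pi(a|s)$ for some $\omega\ge0$, and $\pi_0(a|s)=\frac1{|\mathcal A|}$ for all $s\in\mathcal S,a\in\mathcal A$. Let $\Psi\in\mathbb R^{(|\mathcal S||\mathcal A|)\times d}$ and suppose the estimators used in the update are linearly parametrized, $\mathcal Q_k=\Psi\theta_k$ with $\theta_k\in\mathbb R^d$. Then the policy update $$\pi_{k+1}(\cdot|s)=\arg\min_{p(\cdot|s)\in\Delta_{|\mathcal A|}}\Big\{\lambda_k\big[\langle\mathcal Q_k(s,\cdot),p(\cdot|s)\rangle+h^p(s)\big]+D_{\pi_k}^p(s)\Big\},\quad\forall s\in\mathcal S,\ k\ge0,$$ can be equivalently written in $\mathbb R^d$ as $$\widetilde\theta_0=\mathbf 0,\qquad\widetilde\theta_{k+1}=-\frac{\lambda_k}{1+\lambda_k\omega}\theta_k+\frac1{1+\lambda_k\omega}\widetilde\theta_k,\quad k\ge0,$$ in the sense that $\pi_k(\cdot|s)\propto\exp\big((\Psi\widetilde\theta_k)(s,\cdot)\big)$ for all $s\in\mathcal S$ and $k\ge0$.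
   Context: $\mathcal S,\mathcal A$ are finite sets; a policy $\pi$ assigns to each $s\in\mathcal S$ a distribution $\pi(\cdot|s)\in\Delta_{|\mathcal A|}$ on $\mathcal A$. $D_{\pi'}^\pi(s)=\sum_a\pi(a|s)\log\frac{\pi(a|s)}{\pi'(a|s)}$ is the KL divergence. $\lambda_k>0$ are stepsizes. $(\Psi\theta)(s,\cdot)\in\mathbb R^{|\mathcal A|}$ denotes the block of $\Psi\theta\in\mathbb R^{|\mathcal S||\mathcal A|}$ indexed by the state $s$, and $p\propto v$ means $p=v/\sum_a v_a$. *)

(* Defs.v *)
From HB Require Import structures.
From mathcomp Require Import all_boot all_order all_algebra.
From mathcomp Require Import all_classical all_reals all_analysis.

Set Implicit Arguments.
Unset Strict Implicit.
Unset Printing Implicit Defensive.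

Import Order.TTheory GRing.Theory Num.Theory.

Local Open Scope classical_set_scope.
Local Open Scope ring_scope.

Definition simplex (R : realType) (A : finType) : set (A -> R) :=
  [set p | (forall a, 0 <= p a) /\ \sum_a p a = 1].

(* [policy R S A] is the raw type of kernels; [pi s] is the row pi(.|s), and
   the constraint [simplex (pi s)] is imposed where it is needed. *)
Definition policy (R : realType) (S A : finType) := S -> A -> R.

(* [ln 0 = 0], so the summand is 0 when [p a = 0]. *)
Definition neg_entropy (R : realType) (A : finType) (omega : R) (p : A -> R)
    : R :=
  omega * (\sum_a p a * ln (p a)).

(* KL divergence of p from q, i.e. D^p_q. The sum is taken in \bar R, where
   r / 0 = +oo for r > 0, lne 0 = -oo and 0 * -oo = 0: a summand is thus 0 if
   [p a = 0], and +oo if [q a = 0 < p a]. *)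
Definition kl (R : realType) (A : finType) (q p : A -> R) : \bar R :=
  (\sum_a (p a)%:E * lne ((p a)%:E / (q a)%:E))%E.

Definition argmin (R : realType) (X : Type) (D : set X) (f : X -> \bar R)
    : set X :=
  [set x | D x /\ forall y, D y -> (f x <= f y)%E].

(* R^{|S||A|} is realised as column vectors indexed by the enumeration of
   S * A; [block v s] is v(s, .). *)
Definition block (R : realType) (S A : finType) (v : 'cV[R]_#|{: S * A}|)
    (s : S) : A -> R :=
  fun a => v (enum_rank (s, a)) ord0.

Definition pmd_objective (R : realType) (A : finType) (lambda : R)
    (h : (A -> R) -> R) (Q q p : A -> R) : \bar R :=
  ((lambda * ((\sum_a Q a * p a) + h p))%:E + kl q p)%E.

(* [pi'] is obtained from [pi] by one policy update, state by state. *)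
Definition pmd_step (R : realType) (S A : finType) (lambda : R)
    (h : (A -> R) -> R) (Q : 'cV[R]_#|{: S * A}|) (pi pi' : policy R S A)
    : Prop :=
  forall s, argmin (@simplex R A) (pmd_objective lambda h (block Q s) (pi s))
              (pi' s).

Definition propto (R : realType) (A : finType) (p v : A -> R) : Prop :=
  forall a, p a = v a / \sum_b v b.

(* Main.v *)
(* With a softmax reference policy, the objective of one update is, up to an
   additive constant, [1 + lambda * omega] times the KL divergence from the
   softmax of [(w - lambda Q) / (1 + lambda * omega)]. By Gibbs' inequality and
   its equality case this softmax is the unique minimizer, so that softmax
   policies are propagated by an affine recursion on their logits. *)
Require Import Defs.
From HB Require Import structures.
From mathcomp Require Import all_boot all_order all_algebra.
From mathcomp Require Import all_classical all_reals all_analysis.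
From mathcomp Require Import ring.

Set Implicit Arguments.
Unset Strict Implicit.
Unset Printing Implicit Defensive.

Import Order.TTheory GRing.Theory Num.Theory.
Local Open Scope ring_scope.

(** For [p > 0] and [t = ln q - ln p], the expression is [p * (expR t - (1 + t))]: the exponential
    lies above its tangent at 0, strictly so for [t != 0]. For [p = 0] only [q > 0] is left. *)
Lemma xlogx_tangent_ge0 (R : realType) (p q : R) : 0 <= p -> 0 < q ->
  0 <= p * (ln p - ln q) - p + q ?= iff (p == q).
Proof.
move=> p0 q0; move: p0; rewrite le_eqVlt => /predU1P[<-|p0].
  by rewrite mul0r subr0 add0r; split; first exact: ltW.
have -> : p * (ln p - ln q) - p + q =
    p * (expR (ln q - ln p) - (1 + (ln q - ln p))).
  by rewrite expRB !lnK ?posrE//; field; exact: lt0r_neq0.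
have [->|pq] := eqVneq p q.
  by rewrite subrr expR0 addr0 subrr mulr0; split; rewrite ?eqxx.
have lnpq : ln q - ln p != 0.
  by rewrite subr_eq0; apply: contra pq => /eqP /ln_inj -> //.
have gt0 : 0 < p * (expR (ln q - ln p) - (1 + (ln q - ln p))).
  by rewrite mulr_gt0// subr_gt0 expR_gt1Dx.
by split; [exact: ltW | rewrite lt_eqF].
Qed.

Lemma gibbs_inequality (R : realType) (A : finType) (p q : A -> R) :
  simplex p -> simplex q -> (forall a, 0 < q a) ->
  0 <= \sum_a p a * (ln (p a) - ln (q a)) ?= iff [forall a, p a == q a].
Proof.
move=> [p0 p1] [_ q1] q0.
(* Both masses are 1, so the correction [- p a + q a] sums to 0; it makes each summand nonnegative,
   and equality can then be read off termwise. *)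
have -> : \sum_a p a * (ln (p a) - ln (q a)) =
    \sum_a (p a * (ln (p a) - ln (q a)) - p a + q a).
  by rewrite big_split/= sumrB p1 q1 subrK.
have := leif_sum (fun a (_ : true) => xlogx_tangent_ge0 (p0 a) (q0 a)).
by rewrite big1.
Qed.

Section softmax.
Variables (R : realType) (A : finType).
Hypothesis A_gt0 : (0 < #|A|)%N.
Implicit Types (p q w Q : A -> R) (lambda omega : R).

Lemma sum_expR_gt0 w : 0 < \sum_a expR (w a).
Proof.
have /card_gt0P[a _] := A_gt0.
rewrite (bigD1 a)//= ltr_pwDl ?expR_gt0//.
by apply: sumr_ge0 => b _; exact: expR_ge0.
Qed.

Lemma propto_expR_gt0 p w : propto p (fun a => expR (w a)) ->
  forall a, 0 < p a.
Proof. by move=> pw a; rewrite pw divr_gt0 ?expR_gt0 ?sum_expR_gt0. Qed.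

Lemma propto_expR_simplex p w : propto p (fun a => expR (w a)) -> simplex p.
Proof.
move=> pw; split=> [a|]; first exact/ltW/(propto_expR_gt0 pw).
rewrite (eq_bigr _ (fun a _ => pw a)) -mulr_suml divff//.
exact/lt0r_neq0/sum_expR_gt0.
Qed.

Lemma ln_propto_expR p w : propto p (fun a => expR (w a)) ->
  forall a, ln (p a) = w a - ln (\sum_b expR (w b)).
Proof.
move=> pw a.
by rewrite pw ln_div ?posrE ?expR_gt0 ?sum_expR_gt0// expRK.
Qed.

(** Full support of [q] rules out infinite summands, so that objectives can be compared in [R]. *)
Lemma kl_EFin q p : (forall a, 0 < q a) -> (forall a, 0 <= p a) ->
  kl q p = (\sum_a p a * (ln (p a) - ln (q a)))%:E.
Proof.
move=> q0 p0; rewrite /kl -sumEFin; apply: eq_bigr => a _.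
have := p0 a; rewrite le_eqVlt => /predU1P[<-|pa0].
  by rewrite mul0e mul0r.
rewrite inver gt_eqF// -EFinM lne_EFin ?divr_gt0//.
by rewrite -EFinM ln_div ?posrE.
Qed.

(** The entropy and the divergence together contribute [1 + lambda * omega] times [p ln p]; the
    terms linear in [p] match because [(1 + lambda * omega) * w' = w - lambda * Q], and the two
    log-normalizers form the constant. *)
Lemma pmd_objective_softmax lambda omega Q q p r w w' :
  1 + lambda * omega != 0 ->
  propto q (fun a => expR (w a)) -> propto r (fun a => expR (w' a)) ->
  (forall a, w' a = (w a - lambda * Q a) / (1 + lambda * omega)) ->
  simplex p ->
  pmd_objective lambda (neg_entropy omega) Q q p =
  ((1 + lambda * omega) * (\sum_a p a * (ln (p a) - ln (r a)))
   + (ln (\sum_a expR (w a))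
      - (1 + lambda * omega) * ln (\sum_a expR (w' a))))%:E.
Proof.
move=> c0 qw rw w'E [p0 p1].
rewrite /pmd_objective /neg_entropy (kl_EFin (propto_expR_gt0 qw) p0) -EFinD.
(* Writing the constant as [\sum_a p a] times itself reduces the identity to one per action. *)
congr EFin; rewrite -[X in _ = _ + X]mul1r -[X in X * (_ - _)]p1.
rewrite mulrDr !mulr_sumr mulr_suml -!big_split/=.
apply: eq_bigr => a _.
rewrite (ln_propto_expR qw) (ln_propto_expR rw) w'E; field.
exact: c0.
Qed.

Lemma pmd_argmin_softmax lambda omega Q q p w w' :
  0 < 1 + lambda * omega ->
  propto q (fun a => expR (w a)) ->
  (forall a, w' a = (w a - lambda * Q a) / (1 + lambda * omega)) ->
  argmin (@simplex R A) (pmd_objective lambda (neg_entropy omega) Q q) p <->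
  propto p (fun a => expR (w' a)).
Proof.
move=> c_gt0 qw w'E.
pose r a := expR (w' a) / \sum_b expR (w' b).
have rw : propto r (fun a => expR (w' a)) by [].
have r1 := propto_expR_simplex rw.
have r0 := propto_expR_gt0 rw.
have objE := pmd_objective_softmax (lt0r_neq0 c_gt0) qw rw w'E.
have rr : \sum_a r a * (ln (r a) - ln (r a)) = 0.
  by apply: big1 => a _; rewrite subrr mulr0.
split=> [[p1 /(_ r r1)]|pw].
  (* Tested against [r], a minimizer [p] has divergence at most 0 from [r]; the equality case of
     Gibbs then forces [p = r]. *)
  rewrite !objE// lee_fin lerD2r ler_pM2l// rr => le0.
  have gibbs := gibbs_inequality p1 r1 r0.
  move: le0; rewrite (ge_leif gibbs) => /forallP pr a.
  by rewrite (eqP (pr a)).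
have -> : p = r by apply/funext => a; rewrite pw.
split=> // y y1; rewrite !objE// lee_fin lerD2r ler_pM2l// rr.
exact: gibbs_inequality.
Qed.

End softmax.

Theorem lemma3 (R : realType) (S A : finType) (hA : (0 < #|A|)%N) (d : nat)
    (omega : R) (homega : 0 <= omega)
    (lambda : nat -> R) (hlambda : forall k, 0 < lambda k)
    (Psi : 'M[R]_(#|{: S * A}|, d))
    (theta : nat -> 'cV[R]_d)
    (Q : nat -> 'cV[R]_#|{: S * A}|) (hQ : forall k, Q k = Psi *m theta k)
    (ttheta : nat -> 'cV[R]_d)
    (htheta0 : ttheta 0%N = 0)
    (hthetaS : forall k, ttheta k.+1 =
       - (lambda k / (1 + lambda k * omega)) *: theta k
       + (1 / (1 + lambda k * omega)) *: ttheta k)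
    (pi : nat -> policy R S A)
    (hpi0 : forall s a, pi 0%N s a = 1 / #|A|%:R) :
  (forall k, pmd_step (lambda k) (neg_entropy omega) (Q k) (pi k) (pi k.+1))
  <->
  (forall k s, propto (pi k s) (fun a => expR (block (Psi *m ttheta k) s a))).
Proof.
have c_gt0 k : 0 < 1 + lambda k * omega.
  by rewrite ltr_pwDl// mulr_ge0// ltW.
(* Applying [Psi] to the recursion turns [theta k] into [Q k], which gives the relation between
   successive logits. *)
have logitS k s a : block (Psi *m ttheta k.+1) s a =
    (block (Psi *m ttheta k) s a - lambda k * block (Q k) s a)
    / (1 + lambda k * omega).
  rewrite hQ hthetaS mulmxDr -!scalemxAr /block !mxE; field.
  exact/lt0r_neq0.
have step k s : propto (pi k s) (fun a => expR (block (Psi *m ttheta k) s a)) ->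
    argmin (@simplex R A)
      (pmd_objective (lambda k) (neg_entropy omega) (block (Q k) s) (pi k s))
      (pi k.+1 s) <->
    propto (pi k.+1 s) (fun a => expR (block (Psi *m ttheta k.+1) s a)).
  by move=> soft; apply: pmd_argmin_softmax soft (logitS k s).
(* [step] presupposes a softmax policy at time [k]: the forward direction obtains it by induction,
   the converse from its hypothesis. *)
split=> [upd|soft k s].
  elim=> [|k IH] s; last exact/(step k s (IH s))/upd.
  move=> a; rewrite hpi0 htheta0 mulmx0 /block.
  (* Zero logits give weights 1 and normalizer [#|A|], which is the uniform policy. *)
  under eq_bigr do rewrite mxE expR0.
  by rewrite mxE expR0 sumr_const.
exact/(step k s (soft k s))/soft.
Qed.
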